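(* Let $\mathbf{D}$ be any category and let $S$ be a set of $(\mathbb{R},\leq)$-indexed diagrams in $\mathbf{D}$. Declare $F,G\in S$ equivalent if their interleaving distance $d(F,G)$ is $0$. This is an equivalence relation, and $d$ induces an extended metric (a metric allowed to take the value $\infty$) on the set of equivalence classes.
   Context: $(\mathbb{R},\leq)$ denotes the poset of real numbers viewed as a category. An $(\mathbb{R},\leq)$-indexed diagram in $\mathbf{D}$ is a functor $F:(\mathbb{R},\leq)\to\mathbf{D}$. For $b\geq 0$, $T_b:(\mathbb{R},\leq)\to(\mathbb{R},\leq)$ is the functor $T_b(a)=a+b$, and $\eta_b:\mathrm{Id}\Rightarrow T_b$ is the natural transformation with components $a\leq a+b$. For $\varepsilon\geq 0$, an $\varepsilon$-interleaving of $F$ and $G$ consists of natural transformations $\varphi:F\Rightarrow GT_\varepsilon$ and $\psi:G\Rightarrow FT_\varepsilon$ such that $(\psi T_\varepsilon)\varphi=F\eta_{2\varepsilon}$ and $(\varphi T_\varepsilon)\psi=G\eta_{2\varepsilon}$, i.e. for all $a\in\mathbb{R}$, $\psi(a+\varepsilon)\varphi(a)=F(a\leq a+2\varepsilon)$ and $\varphi(a+\varepsilon)\psi(a)=G(a\leq a+2\varepsilon)$. If one exists, $F$ and $G$ are called $\varepsilon$-interleaved. The interleaving distance is $d(F,G)=\inf\{\varepsilon\geq 0 \mid F \text{ and } G \text{ are } \varepsilon\text{-interleaved}\}$, with $d(F,G)=\infty$ if $F$ and $G$ are not $\varepsilon$-interleaved for any $\varepsilon\geq 0$. *)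

(* Defs.v *)
From Stdlib Require Export RelationClasses.
From mathcomp Require Export all_boot all_order all_algebra.
From mathcomp Require Export all_classical all_reals interval_inference ereal.

Set Implicit Arguments.
Unset Strict Implicit.
Unset Printing Implicit Defensive.

Import Order.TTheory GRing.Theory Num.Theory.

Local Open Scope classical_set_scope.
Local Open Scope ring_scope.

Record category := Category {
  obj :> Type;
  hom : obj -> obj -> Type;
  cid : forall a, hom a a;
  ccomp : forall a b c, hom b c -> hom a b -> hom a c;
  ccomp1l : forall a b (f : hom a b), ccomp (cid b) f = f;
  ccomp1r : forall a b (f : hom a b), ccomp f (cid a) = f;
  ccompA : forall a b c d (h : hom c d) (g : hom b c) (f : hom a b),
    ccomp h (ccomp g f) = ccomp (ccomp h g) f }.

Arguments cid {c} a : rename.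

Notation "g \c f" := (ccomp g f) (at level 50, left associativity).

Record functor (C D : category) := Functor {
  fobj :> C -> D;
  fmap : forall a b : C, hom a b -> hom (fobj a) (fobj b);
  fmap1 : forall a : C, fmap (cid a) = cid (fobj a);
  fmap_comp : forall (a b c : C) (g : hom b c) (f : hom a b),
    fmap (g \c f) = fmap g \c fmap f }.

Arguments fmap {C D} f {a b} : rename.

Record nat_trans (C D : category) (F G : functor C D) := NatTrans {
  component :> forall a : C, hom (F a) (G a);
  naturality : forall (a b : C) (f : hom a b),
    fmap G f \c component a = component b \c fmap F f }.

Definition functor_id (C : category) : functor C C :=
  @Functor C C id (fun _ _ f => f) (fun=> erefl) (fun _ _ _ _ _ => erefl).

Section FunctorComp.
Context (B C D : category) (G : functor C D) (F : functor B C).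

Let fcomp_map (a b : B) (f : hom a b) : hom (G (F a)) (G (F b)) :=
  fmap G (fmap F f).

Fact fcomp_map1 (a : B) : fcomp_map (cid a) = cid (G (F a)).
Proof. by rewrite /fcomp_map !fmap1. Qed.

Fact fcomp_map_comp (a b c : B) (g : hom b c) (f : hom a b) :
  fcomp_map (g \c f) = fcomp_map g \c fcomp_map f.
Proof. by rewrite /fcomp_map !fmap_comp. Qed.

Definition functor_comp : functor B D :=
  @Functor B D (fun a => G (F a)) fcomp_map fcomp_map1 fcomp_map_comp.

End FunctorComp.

Section RealPoset.
Context (R : realType).

(* The hom-sets are the types of proofs of a boolean inequality, hence contain
   at most one element. *)
Definition real_cat : category := @Category R
  (fun a b => a <= b) (fun a => lexx a)
  (fun _ _ _ bc ab => le_trans ab bc)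
  (fun _ _ _ => bool_irrelevance _ _)
  (fun _ _ _ => bool_irrelevance _ _)
  (fun _ _ _ _ _ _ _ => bool_irrelevance _ _).

Fact shift_map (b : R) (x y : real_cat) :
  @hom real_cat x y -> @hom real_cat (x + b) (y + b).
Proof. by move=> xy; rewrite /hom/= lerD2r. Qed.

Definition shift (b : {nonneg R}) : functor real_cat real_cat :=
  @Functor real_cat real_cat (fun a => a + b%:num) (shift_map b%:num)
    (fun _ => bool_irrelevance _ _) (fun _ _ _ _ _ => bool_irrelevance _ _).

Fact shift_ge (b : {nonneg R}) (a : real_cat) :
  @hom real_cat a (shift b a).
Proof. by rewrite /hom/= lerDl. Qed.

Definition eta (b : {nonneg R}) : nat_trans (functor_id real_cat) (shift b) :=
  @NatTrans real_cat real_cat (functor_id real_cat) (shift b) (shift_ge b)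
    (fun _ _ _ => bool_irrelevance _ _).

Definition double (e : {nonneg R}) : {nonneg R} := (2 * e%:num)%:nng.

(* The equality (a + e) + e = a + 2 * e is not definitional; this morphism of
   the poset expresses the resulting identification of objects. *)
Fact shift_shift (e : {nonneg R}) (a : real_cat) :
  @hom real_cat (shift e (shift e a)) (shift (double e) a).
Proof. by rewrite /hom/= -addrA mulr_natl mulr2n. Qed.

End RealPoset.

Notation diagram R D := (functor (real_cat R) D).

Section Interleaving.
Context (R : realType) (D : category).
Implicit Types (e : {nonneg R}) (F G : diagram R D).

Definition is_interleaving e F G
    (phi : nat_trans F (functor_comp G (shift e)))
    (psi : nat_trans G (functor_comp F (shift e))) : Prop :=
  (forall a : real_cat R,
     fmap F (shift_shift e a) \c (psi (shift e a) \c phi a)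
     = fmap F (eta (double e) a)) /\
  (forall a : real_cat R,
     fmap G (shift_shift e a) \c (phi (shift e a) \c psi a)
     = fmap G (eta (double e) a)).

Definition interleaved e F G : Prop :=
  exists phi psi, @is_interleaving e F G phi psi.

(* The infimum of the empty set is +oo. *)
Definition interleaving_dist F G : \bar R :=
  ereal_inf [set e%:num%:E | e in [set e | interleaved e F G]].

End Interleaving.

Section Quotient.
Context (T : Type) (r : T -> T -> Prop).

Definition eq_class (x : T) : set T := [set y | r x y].

Definition eq_classes : set (set T) := range eq_class.

Definition to_class (x : T) : eq_classes :=
  SigSub (mem_set (imageT eq_class x)).

End Quotient.

Record extended_metric (R : realType) (X : Type) (d : X -> X -> \bar R) : Prop :=
  ExtendedMetric {
    emetric_ge0 : forall x y, (0 <= d x y)%E;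
    emetric_eq0 : forall x y, d x y = 0%E <-> x = y;
    emetric_sym : forall x y, d x y = d y x;
    emetric_triangle : forall x y z, (d x z <= d x y + d y z)%E }.

(* Main.v *)
Require Import Defs.

(** Composing an [e1]-interleaving of [F] and [G] with an [e2]-interleaving of
    [G] and [H] gives an [e]-interleaving of [F] and [H] for every
    [e >= e1 + e2] ([interleaved_trans]); taking infima, the interleaving
    distance satisfies the triangle inequality.  It is symmetric because the
    definition of an interleaving is, it is nonnegative, and it vanishes on the
    diagonal because [F eta_0] is a [0]-interleaving of [F] with itself.  So it
    is an extended pseudometric on diagrams, and an extended pseudometric [p]
    always descends to an extended metric on the classes of [p x y = 0], since
    by the triangle inequality [p] is constant on pairs of classes
    ([quotient_metric]).

    The two equations of an interleaving are exchanged by swapping the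
    diagrams, so each composite need only be verified once: only the
    equation at [F], called [roundtrip] below, is studied.  In the composite
    [F -> G -> H -> G -> F], naturality moves the structure maps of [H]
    outwards, the inner loop [G -> H -> G] collapses to a structure map of [G],
    naturality moves this one to [F], and the loop [F -> G -> F] collapses.  As
    a poset has at most one morphism between two objects, the structure maps of
    [F] that remain compose to the one required. *)

Set Implicit Arguments.
Unset Strict Implicit.
Unset Printing Implicit Defensive.

Import Order.TTheory GRing.Theory Num.Theory.

Local Open Scope classical_set_scope.
Local Open Scope ring_scope.

(** * Composition of interleavings *)

Section Composition.
Context (R : realType) (D : category).
Implicit Types (e : {nonneg R}) (F G H : diagram R D).

(** The three inequality proofs are independent of each other, so that
    rewriting with this lemma absorbs the irrelevance of proofs in the poset. *)
Lemma fmap_real_comp F (a b c : real_cat R) (g : hom b c) (f : hom a b)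
    (h : hom a c) :
  fmap F g \c fmap F f = fmap F h.
Proof. by rewrite -fmap_comp; congr fmap; exact: bool_irrelevance. Qed.

Definition roundtrip e F G (phi : nat_trans F (functor_comp G (shift e)))
    (psi : nat_trans G (functor_comp F (shift e))) : Prop :=
  forall a : real_cat R,
    fmap F (shift_shift e a) \c (psi (shift e a) \c phi a)
    = fmap F (eta (double e) a).

(** Ending the round trip at an arbitrary [c] above [a + e + e] lets it be used
    inside a longer composite, where it is followed by a further structure
    map. *)
Lemma roundtrip_to e F G (phi : nat_trans F (functor_comp G (shift e)))
    (psi : nat_trans G (functor_comp F (shift e))) (a c : real_cat R)
    (u : hom (shift e (shift e a)) c) (v : hom a c) :
  roundtrip phi psi -> fmap F u \c (psi (shift e a) \c phi a) = fmap F v.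
Proof.
move=> rt.
have w : @hom (real_cat R) (shift (double e) a) c.
  by move: u; rewrite /hom/= -addrA mulr_natl mulr2n.
by rewrite -(fmap_real_comp F w (shift_shift e a) u) -ccompA rt
  (fmap_real_comp F _ _ v).
Qed.

Fact shift_add_le e1 e2 e (le_e : e1%:num + e2%:num <= e%:num)
    (a : real_cat R) :
  @hom (real_cat R) (shift e2 (shift e1 a)) (shift e a).
Proof. by rewrite /hom/= -addrA lerD2l. Qed.

Definition shift_trans_comp_component e1 e2 e
    (le_e : e1%:num + e2%:num <= e%:num) F G H
    (phi1 : nat_trans F (functor_comp G (shift e1)))
    (phi2 : nat_trans G (functor_comp H (shift e2))) (a : real_cat R) :
  hom (F a) (functor_comp H (shift e) a) :=
  fmap H (shift_add_le le_e a) \c (phi2 (shift e1 a) \c phi1 a).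

Fact shift_trans_comp_natural e1 e2 e
    (le_e : e1%:num + e2%:num <= e%:num) F G H
    (phi1 : nat_trans F (functor_comp G (shift e1)))
    (phi2 : nat_trans G (functor_comp H (shift e2))) (a b : real_cat R)
    (f : hom a b) :
  fmap (functor_comp H (shift e)) f
    \c shift_trans_comp_component le_e phi1 phi2 a
  = shift_trans_comp_component le_e phi1 phi2 b \c fmap F f.
Proof.
rewrite /shift_trans_comp_component -!ccompA.
rewrite -(naturality phi1 f).
rewrite (ccompA (phi2 (shift e1 b))) -(naturality phi2 (fmap (shift e1) f)).
rewrite /= !ccompA; congr (_ \c _ \c _).
rewrite (fmap_real_comp H _ _
  (le_trans (shift_add_le le_e a) (fmap (shift e) f))).
by rewrite -fmap_comp; congr fmap; exact: bool_irrelevance.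
Qed.

(** Allowing any [e >= e1 + e2], and not only the sum, makes the two
    composites [F -> G -> H] and [H -> G -> F] shift by the same [e], although
    [e1 + e2] and [e2 + e1] are not convertible. *)
Definition shift_trans_comp e1 e2 e (le_e : e1%:num + e2%:num <= e%:num) F G H
    (phi1 : nat_trans F (functor_comp G (shift e1)))
    (phi2 : nat_trans G (functor_comp H (shift e2))) :
  nat_trans F (functor_comp H (shift e)) :=
  NatTrans (shift_trans_comp_natural le_e phi1 phi2).

(** The loop through [H] is collapsed first, then the loop through [G]. *)
Lemma roundtrip_comp e1 e2 e (le12 : e1%:num + e2%:num <= e%:num)
    (le21 : e2%:num + e1%:num <= e%:num) F G H
    (phi1 : nat_trans F (functor_comp G (shift e1)))
    (psi1 : nat_trans G (functor_comp F (shift e1)))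
    (phi2 : nat_trans G (functor_comp H (shift e2)))
    (psi2 : nat_trans H (functor_comp G (shift e2))) :
  roundtrip phi1 psi1 -> roundtrip phi2 psi2 ->
  roundtrip (shift_trans_comp le12 phi1 phi2)
            (shift_trans_comp le21 psi2 psi1).
Proof.
move=> rt1 rt2 a.
rewrite /= /shift_trans_comp_component.
set u := shift_add_le le12 a.
have v : @hom (real_cat R) (shift e1 a) (shift e2 (shift e a)).
  exact: le_trans (shift_ge e2 _) (shift_map e2%:num
    (le_trans (shift_ge e2 (shift e1 a)) u)).
have loopH : psi2 (shift e a) \c (fmap H u \c (phi2 (shift e1 a) \c phi1 a))
    = fmap G v \c phi1 a.
  rewrite !ccompA -(naturality psi2 u) -(ccompA _ (psi2 _)).
  by congr (_ \c _); exact: roundtrip_to.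
rewrite -!ccompA loopH (ccompA (psi1 _)) -(naturality psi1 v) -ccompA.
rewrite /= !ccompA -!fmap_comp -ccompA.
exact: roundtrip_to.
Qed.

Lemma interleaved_sym e F G : interleaved e F G -> interleaved e G F.
Proof. by move=> [phi [psi [rtF rtG]]]; exists psi, phi. Qed.

Lemma interleaved_trans e1 e2 e F G H : e1%:num + e2%:num <= e%:num ->
  interleaved e1 F G -> interleaved e2 G H -> interleaved e F H.
Proof.
move=> le12 [phi1 [psi1 [rtF rtG1]]] [phi2 [psi2 [rtG2 rtH]]].
have le21 : e2%:num + e1%:num <= e%:num by rewrite addrC.
exists (shift_trans_comp le12 phi1 phi2), (shift_trans_comp le21 psi2 psi1).
by split; exact: roundtrip_comp.
Qed.

Fact diagram_eta_natural e F (a b : real_cat R) (f : hom a b) :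
  fmap (functor_comp F (shift e)) f \c fmap F (eta e a)
  = fmap F (eta e b) \c fmap F f.
Proof. by rewrite /= -!fmap_comp; congr fmap; exact: bool_irrelevance. Qed.

Definition diagram_eta e F : nat_trans F (functor_comp F (shift e)) :=
  NatTrans (@diagram_eta_natural e F).

Lemma interleaved_refl e F : interleaved e F F.
Proof.
have rt : roundtrip (diagram_eta e F) (diagram_eta e F).
  move=> a; rewrite /= (fmap_real_comp F _ _
    (le_trans (shift_ge e a) (shift_ge e (shift e a)))).
  exact: fmap_real_comp.
by exists (diagram_eta e F), (diagram_eta e F).
Qed.

End Composition.

(** * The interleaving distance is an extended pseudometric *)

Section Distance.
Context (R : realType) (D : category).
Implicit Types F G H : diagram R D.

Lemma interleaving_dist_le (e : {nonneg R}) F G : interleaved e F G ->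
  (interleaving_dist F G <= e%:num%:E)%E.
Proof. by move=> FG; apply: ereal_inf_lbound; exists e. Qed.

Lemma le_interleaving_dist (x : \bar R) F G :
  (forall e : {nonneg R}, interleaved e F G -> (x <= e%:num%:E)%E) ->
  (x <= interleaving_dist F G)%E.
Proof. by move=> xle; apply: le_ereal_inf_tmp => _ [e FG <-]; exact: xle. Qed.

Lemma interleaving_dist_ge0 F G : (0 <= interleaving_dist F G)%E.
Proof. by apply: le_interleaving_dist => e _; rewrite lee_fin. Qed.

Lemma interleaving_dist_refl F : interleaving_dist F F = 0%E.
Proof.
apply/eqP; rewrite eq_le interleaving_dist_ge0 andbT.
exact: (interleaving_dist_le (interleaved_refl 0%:nng F)).
Qed.

Lemma interleaving_dist_sym F G :
  interleaving_dist F G = interleaving_dist G F.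
Proof.
by apply/eqP; rewrite eq_le; apply/andP; split;
  apply: le_interleaving_dist => e /interleaved_sym; exact: interleaving_dist_le.
Qed.

Lemma interleaving_dist_triangle F G H :
  (interleaving_dist F H <= interleaving_dist F G + interleaving_dist G H)%E.
Proof.
have [FGoo|FGfin] := eqVneq (interleaving_dist F G) +oo%E.
  rewrite FGoo addye ?leey //.
  by rewrite gt_eqF // (lt_le_trans _ (interleaving_dist_ge0 _ _)).
(* The two infima are bounded one at a time; subtracting the first from both
   sides is legitimate because it is finite. *)
have {}FGfin : interleaving_dist F G \is a fin_num.
  by rewrite ge0_fin_numE ?interleaving_dist_ge0 // lt_neqAle FGfin leey.
rewrite -leeBlDl //; apply: le_interleaving_dist => e2 GH.
rewrite leeBlDl // -leeBlDr //; apply: le_interleaving_dist => e1 FG.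
rewrite leeBlDr // -EFinD.
exact: (interleaving_dist_le
  (interleaved_trans (e := (e1%:num + e2%:num)%:nng) (lexx _) FG GH)).
Qed.

End Distance.

(** * The metric quotient of an extended pseudometric space *)

Section MetricQuotient.
Context (R : realType) (T : Type) (p : T -> T -> \bar R).
Hypothesis p_ge0 : forall x y, (0 <= p x y)%E.
Hypothesis p_refl : forall x, p x x = 0%E.
Hypothesis p_sym : forall x y, p x y = p y x.
Hypothesis p_triangle : forall x y z, (p x z <= p x y + p y z)%E.

Let r (x y : T) : Prop := p x y = 0%E.

Lemma pseudometric_congr x x' y : r x x' -> p x y = p x' y.
Proof.
move=> xx'; apply/eqP; rewrite eq_le; apply/andP; split.
  by apply: le_trans (p_triangle x x' y) _; rewrite xx' add0e.
by apply: le_trans (p_triangle x' x y) _; rewrite p_sym xx' add0e.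
Qed.

Lemma dist0_equivalence : Equivalence r.
Proof.
split=> [x|x y|x y z xy yz]; first exact: p_refl.
  by rewrite /r p_sym.
by rewrite /r (pseudometric_congr z xy).
Qed.

Lemma to_class_eq x y : to_class r x = to_class r y <-> r x y.
Proof.
split=> [/(congr1 val) /= xy|xy].
  have : eq_class r y y by exact: p_refl.
  by rewrite -xy.
by apply/val_inj/seteqP; split=> z /=;
  rewrite /eq_class /= /r (pseudometric_congr z xy).
Qed.

Lemma to_class_surj (X : eq_classes r) : exists x, to_class r x = X.
Proof. by have [x _ xX] := set_mem (valP X); exists x; exact: val_inj. Qed.

Lemma quotient_metric : exists d : eq_classes r -> eq_classes r -> \bar R,
  (forall x y, d (to_class r x) (to_class r y) = p x y) /\ extended_metric d.
Proof.
have [rep repK] := boolp.choice to_class_surj.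
exists (fun X Y => p (rep X) (rep Y)); split=> [x y|].
  have repr_r z : r (rep (to_class r z)) z by apply/to_class_eq; exact: repK.
  rewrite (pseudometric_congr _ (repr_r x)) p_sym.
  by rewrite (pseudometric_congr _ (repr_r y)) p_sym.
split=> // X Y.
by rewrite -/(r _ _) -to_class_eq !repK.
Qed.

End MetricQuotient.

Theorem corollary3p5 (R : realType) (D : category) (S : set (diagram R D)) :
  let r (F G : S) := interleaving_dist (\val F) (\val G) = 0%E in
  Equivalence r /\
  exists d : eq_classes r -> eq_classes r -> \bar R,
    (forall F G : S,
       d (to_class r F) (to_class r G) = interleaving_dist (\val F) (\val G)) /\
    extended_metric d.
Proof.
set p := fun F G : S => interleaving_dist (\val F) (\val G).
have p_ge0 F G : (0 <= p F G)%E by exact: interleaving_dist_ge0.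
have p_refl F : p F F = 0%E by exact: interleaving_dist_refl.
have p_sym F G : p F G = p G F by exact: interleaving_dist_sym.
have p_triangle F G H : (p F H <= p F G + p G H)%E.
  exact: interleaving_dist_triangle.
split; [exact: dist0_equivalence | exact: quotient_metric].
Qed.
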